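(* Let $p,l$ be two distinct odd prime numbers. (1) Suppose that $p,l\equiv 7\pmod{24}$, or that each of $p$ and $l$ is congruent to one of $15,23,31,47,71$ modulo $88$. Then there are commuting quaternions $x\in X_p$, $y\in X_l$. (2) Suppose that $p\equiv 1$ and $l\equiv 7\pmod{24}$, or that $p$ is congruent to one of $1,9,25,49,81$ modulo $88$ and $l$ is congruent to one of $15,23,31,47,71$ modulo $88$. Then there are commuting quaternions $x\in X_p$, $y\in X_l$.
   Context: $\mathbb{H}(\mathbb{Z})$ is the ring of Hamilton quaternions $x_0+x_1i+x_2j+x_3k$ with integer coefficients ($i^2=j^2=k^2=-1$, $ij=-ji=k$), with norm $|x|^2=x_0^2+x_1^2+x_2^2+x_3^2$. For an odd prime $q$, $X_q$ is the set of $x=x_0+x_1i+x_2j+x_3k\in\mathbb{H}(\mathbb{Z})$ with $|x|^2=q$ such that: $x_0$ is odd and $x_1,x_2,x_3$ are even if $q\equiv 1\pmod 4$; $x_1$ is even and $x_0,x_2,x_3$ are odd if $q\equiv 3\pmod 4$. *)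

(* Defs.v *)
From HB Require Import structures.
From mathcomp Require Import all_boot all_order all_algebra.
From mathcomp Require Import ring.

Set Implicit Arguments.
Unset Strict Implicit.
Unset Printing Implicit Defensive.

Import GRing.Theory.
Local Open Scope ring_scope.

(* Quat x0 x1 x2 x3 stands for x0 + x1 i + x2 j + x3 k. *)
Record quat (R : Type) : Type :=
  Quat { qre : R; qi : R; qj : R; qk : R }.

Section QuatChoice.

Definition quat_to_prod (R : Type) (x : quat R) : R * R * R * R :=
  (qre x, qi x, qj x, qk x).

Definition quat_of_prod (R : Type) (t : R * R * R * R) : quat R :=
  let: (a, b, c, d) := t in Quat a b c d.

Lemma quat_to_prodK (R : Type) :
  cancel (@quat_to_prod R) (@quat_of_prod R).
Proof. by case. Qed.

HB.instance Definition _ (R : eqType) :=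
  Equality.copy (quat R) (can_type (@quat_to_prodK R)).
HB.instance Definition _ (R : choiceType) :=
  Choice.copy (quat R) (can_type (@quat_to_prodK R)).

End QuatChoice.

Section QuatRing.

Variable R : comNzRingType.
Implicit Types x y z : quat R.

Definition quat_add x y : quat R :=
  Quat (qre x + qre y) (qi x + qi y) (qj x + qj y) (qk x + qk y).

Definition quat_opp x : quat R :=
  Quat (- qre x) (- qi x) (- qj x) (- qk x).

(* Bilinear extension of i^2 = j^2 = k^2 = -1, ij = -ji = k. *)
Definition quat_mul x y : quat R :=
  Quat (qre x * qre y - qi x * qi y - qj x * qj y - qk x * qk y)
       (qre x * qi y + qi x * qre y + qj x * qk y - qk x * qj y)
       (qre x * qj y - qi x * qk y + qj x * qre y + qk x * qi y)
       (qre x * qk y + qi x * qj y - qj x * qi y + qk x * qre y).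

Definition quat_zero : quat R := Quat 0 0 0 0.
Definition quat_one : quat R := Quat 1 0 0 0.

Fact quat_addA : associative quat_add.
Proof. by move=> x y z; rewrite /quat_add /= !addrA. Qed.

Fact quat_addC : commutative quat_add.
Proof. by move=> x y; congr Quat; rewrite addrC. Qed.

Fact quat_add0 : left_id quat_zero quat_add.
Proof. by case=> a b c d; rewrite /quat_add /= !add0r. Qed.

Fact quat_addN : left_inverse quat_zero quat_opp quat_add.
Proof. by move=> x; rewrite /quat_add /= !addNr. Qed.

Fact quat_mulA : associative quat_mul.
Proof. by move=> x y z; congr Quat => /=; ring. Qed.

Fact quat_mul1l : left_id quat_one quat_mul.
Proof. by case=> a b c d; congr Quat => /=; ring. Qed.

Fact quat_mul1r : right_id quat_one quat_mul.
Proof. by case=> a b c d; congr Quat => /=; ring. Qed.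

Fact quat_mulDl : left_distributive quat_mul quat_add.
Proof. by move=> x y z; congr Quat => /=; ring. Qed.

Fact quat_mulDr : right_distributive quat_mul quat_add.
Proof. by move=> x y z; congr Quat => /=; ring. Qed.

Fact quat_oner_neq0 : quat_one != quat_zero.
Proof. by apply/eqP => -[/eqP]; rewrite oner_eq0. Qed.

HB.instance Definition _ := GRing.isZmodule.Build (quat R)
  quat_addA quat_addC quat_add0 quat_addN.

HB.instance Definition _ := GRing.Zmodule_isNzRing.Build (quat R)
  quat_mulA quat_mul1l quat_mul1r quat_mulDl quat_mulDr quat_oner_neq0.

Definition unit_i : quat R := Quat 0 1 0 0.
Definition unit_j : quat R := Quat 0 0 1 0.
Definition unit_k : quat R := Quat 0 0 0 1.

Fact quat_relations :
  [/\ unit_i ^+ 2 = -1, unit_j ^+ 2 = -1, unit_k ^+ 2 = -1,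
      unit_i * unit_j = unit_k & unit_j * unit_i = - unit_k].
Proof. by split; congr Quat => /=; ring. Qed.

(* The squared norm |x|^2, with no square root taken. *)
Definition normsq x : R := qre x ^+ 2 + qi x ^+ 2 + qj x ^+ 2 + qk x ^+ 2.

End QuatRing.

Definition evenz (a : int) : bool := (2 %| a)%Z.
Definition oddz (a : int) : bool := ~~ evenz a.

(* Only used for q an odd prime, so exactly one of the premises holds. *)
Definition X (q : nat) : pred (quat int) := fun x =>
  [&& normsq x == q%:Z,
      (q == 1 %[mod 4])%N ==>
        [&& oddz (qre x), evenz (qi x), evenz (qj x) & evenz (qk x)] &
      (q == 3 %[mod 4])%N ==>
        [&& evenz (qi x), oddz (qre x), oddz (qj x) & oddz (qk x)]].

(* Main.v *)
Require Import Defs.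
From mathcomp Require Import all_boot all_order all_algebra.
From mathcomp Require Import all_field.
From mathcomp Require Import zify ring.

(* Integer quaternions with parallel imaginary parts commute. Along the
   direction (2, 1, 1) the norm is x^2 + 6 y^2, and along (2, 3, 3) it is
   x^2 + 22 y^2; reducing modulo 8, such a representation of a prime p = 1, 7
   (mod 8) automatically satisfies the parity conditions of X p. So it suffices
   to represent p by one of these two forms. First, -6 or -22 is a square
   modulo p: square roots of 2, -3 and -11 are written with roots of unity of
   order 8, 3 and 11 in an algebraic closure of F_p, and the congruences on p
   make them fixed by the Frobenius map. Then p is represented by a form of
   discriminant -24 or -88, and Gauss reduction leaves one competitor,
   2 x^2 + 3 y^2 or 2 x^2 + 11 y^2, which is excluded modulo 3 or 11. *)

Import Order.TTheory GRing.Theory Num.Theory.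
Local Open Scope ring_scope.

(** * Fixed points of Frobenius in characteristic p *)

Lemma pchar_closedField (p : nat) :
  prime p -> exists K : closedFieldType, p \in [pchar K].
Proof.
move=> p_prime.
have [K [f _]] := countable_algebraic_closure ('F_p : countFieldType).
by exists K; rewrite (fmorph_pchar f) pchar_Fp.
Qed.

(** The images of 0, ..., p - 1 are already p distinct roots of ['X^p - 'X], so one more root would
    exceed its degree. *)
Lemma prime_fieldP (K : fieldType) (p : nat) (s : K) :
  p \in [pchar K] -> s ^+ p = s -> exists n : nat, s = n%:R.
Proof.
move=> charK sp; have p_prime := pcharf_prime charK.
pose q : {poly K} := 'X^p - 'X.
have sz_q : size q = p.+1.
  by rewrite size_polyDl ?size_polyXn // size_polyN size_polyX ltnS prime_gt1.
have q_neq0 : q != 0 by rewrite -size_poly_eq0 sz_q.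
have qE t : root q t = (t ^+ p == t).
  by rewrite rootE !hornerE subr_eq0.
pose ns := [seq n%:R : K | n <- iota 0 p].
have [/mapP[n _ ->]|s_notin] := boolP (s \in ns); first by exists n.
suff: (size (s :: ns) < size q)%N by rewrite /= size_map size_iota sz_q ltnn.
apply: (max_poly_roots q_neq0).
  apply/allP => t; rewrite inE => /orP[/eqP->|/mapP[n _ ->]]; rewrite qE ?sp //.
  by rewrite -(pFrobenius_autE charK) rmorph_nat.
rewrite /= s_notin map_inj_in_uniq ?iota_uniq // => i j; rewrite !mem_iota /= => lt_i lt_j.
wlog le_ij : i j lt_i lt_j / (i <= j)%N.
  move=> wlog_ij E; have [/wlog_ij->|/ltnW/wlog_ij->] // := leqP i j.
move/esym/eqP; rewrite -subr_eq0 -natrB // -(dvdn_pcharf charK).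
by rewrite -eqn_mod_dvd // !modn_small // => /eqP.
Qed.

Lemma dvdn_sqrDP (K : fieldType) (p d : nat) (s : K) :
  p \in [pchar K] -> s ^+ p = s -> s ^+ 2 = - d%:R ->
  exists n : nat, (p %| n ^ 2 + d)%N.
Proof.
move=> charK /(prime_fieldP _ _ _ charK)[n ->] nn; exists n.
by rewrite (dvdn_pcharf charK) natrD natrX nn addNr.
Qed.

(** * Square roots of 2, -3 and -11 fixed by Frobenius *)

Section FrobeniusFixedRoots.
Variables (K : closedFieldType) (p : nat) (charK : p \in [pchar K]).

Let FrobD (x y : K) : (x + y) ^+ p = x ^+ p + y ^+ p.
Proof. by rewrite -!(pFrobenius_autE charK) rmorphD. Qed.

Lemma sqrt2_Frob : (p %% 8 \in [:: 1; 7])%N -> exists2 h : K, h ^+ p = h & h ^+ 2 = 2.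
Proof.
have [z] := @solve_monicpoly K 4 (fun i => if i == 0%N then -1 else 0) isT.
rewrite !big_ord_recl big_ord0 /= !mul0r !addr0 mulr1 => z4.
have z8 : z ^+ 8 = 1 by rewrite -[8%N]/(4 * 2)%N exprM z4 sqrrN expr1n.
(* As z^4 = -1, [z ^+ 7] is the inverse of z, and Frobenius fixes or swaps the two. *)
move=> p8; exists (z + z ^+ 7); last by ring: z4.
rewrite FrobD exprAC -(expr_mod p z8).
by move: p8; rewrite !inE => /orP[]/eqP->; ring: z4.
Qed.

Lemma sqrtN3_Frob : (p %% 3 = 1)%N -> exists2 h : K, h ^+ p = h & h ^+ 2 = -3.
Proof.
have [z] := @solve_monicpoly K 2 (fun i => -1) isT.
rewrite !big_ord_recl big_ord0 /= => z2.
have {}z2 : z ^+ 2 = -1 - z by rewrite z2; ring.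
have z3 : z ^+ 3 = 1 by ring: z2.
move=> p3; exists (1 + z + z); last by ring: z2.
by rewrite !FrobD expr1n -(expr_mod p z3) p3.
Qed.

Lemma sqrtN11_Frob : (p %% 11 \in [:: 1; 3; 4; 5; 9])%N ->
  exists2 h : K, h ^+ p = h & h ^+ 2 = -11.
Proof.
have [z] := @solve_monicpoly K 10 (fun i => -1) isT.
rewrite !big_ord_recl big_ord0 /= => z10.
have {}z10 : \sum_(i < 11) z ^+ i = 0.
  by rewrite big_ord_recr /= z10 !big_ord_recl big_ord0 /=; ring.
have z11 : z ^+ 11 = 1.
  by apply/eqP; rewrite -subr_eq0 subrX1 z10 mulr0.
(* The Gaussian period over the squares modulo 11; the cofactor used for g2 is
   the quotient of g^2 + g + 3 by the cyclotomic polynomial. *)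
pose g := z ^+ 1 + z ^+ 3 + z ^+ 4 + z ^+ 5 + z ^+ 9.
have g2 : g ^+ 2 = - 3 - g.
  apply/eqP; rewrite -subr_eq0; apply/eqP.
  transitivity ((z ^+ 8 - z ^+ 7 + 2 * z ^+ 4 - 2 * z + 3) * \sum_(i < 11) z ^+ i).
    by rewrite !big_ord_recl big_ord0 /=; rewrite /g; ring.
  by rewrite z10 mulr0.
(* g is a root of X^2 + X + 3, whose discriminant is -11. *)
move=> p11; exists (1 + g + g); last by ring: g2.
suff gp : g ^+ p = g by rewrite (FrobD _ g) (FrobD 1) expr1n gp.
have zp i : (z ^+ i) ^+ p = z ^+ (i * (p %% 11) %% 11)%N.
  by rewrite modnMmr (expr_mod _ z11) exprM.
(* p is a nonzero square modulo 11, so multiplying by p permutes the exponents 1, 3, 4, 5, 9. *)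
rewrite !FrobD !zp.
by move: p11; rewrite !inE /g => /or4P[|||/orP[]]/eqP->; cbn -[GRing.exp]; ring.
Qed.
End FrobeniusFixedRoots.

(** * -6 and -22 as squares modulo p *)

Lemma dvdn_sqrD6 (p : nat) : prime p -> (p %% 24 \in [:: 1; 7])%N ->
  exists n : nat, (p %| n ^ 2 + 6)%N.
Proof.
move=> p_prime p24; have [K charK] := pchar_closedField _ p_prime.
have [|h hp h2] := sqrt2_Frob K p charK; first by rewrite !inE in p24 *; lia.
have [|w wp w2] := sqrtN3_Frob K p charK; first by rewrite !inE in p24 *; lia.
apply: (dvdn_sqrDP _ _ _ (h * w) charK); rewrite exprMn ?hp ?wp // h2 w2.
ring.
Qed.

Lemma dvdn_sqrD22 (p : nat) : prime p -> (p %% 8 \in [:: 1; 7])%N ->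
  (p %% 11 \in [:: 1; 3; 4; 5; 9])%N -> exists n : nat, (p %| n ^ 2 + 22)%N.
Proof.
move=> p_prime p8 p11; have [K charK] := pchar_closedField _ p_prime.
have [h hp h2] := sqrt2_Frob K p charK p8.
have [w wp w2] := sqrtN11_Frob K p charK p11.
apply: (dvdn_sqrDP _ _ _ (h * w) charK); rewrite exprMn ?hp ?wp // h2 w2.
ring.
Qed.

(** * Gauss reduction of binary quadratic forms *)

Lemma reduce_form (d a b c x y : int) :
  0 < a -> 0 < c -> 0 < d -> a * c = d + b ^+ 2 ->
  exists a' b' c' x' y' : int,
    [/\ 0 < a', a' <= c', `|2 * b'| <= a', a' * c' = d + b' ^+ 2 &
        a * x ^+ 2 + 2 * b * x * y + c * y ^+ 2 =
        a' * x' ^+ 2 + 2 * b' * x' * y' + c' * y' ^+ 2].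
Proof.
move=> a_gt0 c_gt0 d_gt0.
have [n] := ubnP `|(a + c)%R|%N.
elim: n a b c x y a_gt0 c_gt0 => // n IHn a b c x y.
wlog le_ac : a c x y / a <= c.
  move=> wlog_ac a_gt0 c_gt0 le_n disc.
  have [le_ac|lt_ca] := leP a c; first exact: wlog_ac.
  have [||||//|a' [b' [c' [x' [y' [? ? ? ? E]]]]]] := wlog_ac c a y x; try lia.
  exists a', b', c', x', y'; split=> //; rewrite -E; ring.
move=> a_gt0 c_gt0 le_n disc.
have [ba|ab] := leP `|2 * b| a; first by exists a, b, c, x, y.
(* t has the sign opposite to b: replacing x by x - t y keeps a and lowers c to c + 2bt + a, so a +
   c decreases. *)
have [t [t2 bt]] : exists t : int, t ^+ 2 = 1 /\ a + 2 * b * t < 0.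
  by have [b0|b0] := leP 0 b; [exists (-1)|exists 1]; split=> //; lia.
have disc' : a * (c + 2 * b * t + a) = d + (b + a * t) ^+ 2.
  by rewrite !mulrDr disc sqrrD exprMn t2; ring.
have c'_gt0 : 0 < c + 2 * b * t + a.
  by rewrite -(pmulr_rgt0 _ a_gt0) disc' ltr_wpDr ?sqr_ge0.
have [|a' [b' [c' [x' [y' [? ? ? ? E]]]]]] :=
  IHn a (b + a * t) (c + 2 * b * t + a) (x - t * y) y a_gt0 c'_gt0 _ disc'.
  lia.
exists a', b', c', x', y'; split=> //; rewrite -E.
transitivity (a * x ^+ 2 + 2 * b * x * y + c * y ^+ 2 + (1 - t ^+ 2) * (a * y ^+ 2)).
  by rewrite t2 subrr mul0r addr0.
ring.
Qed.

Lemma prime_reduced_form (p d : nat) : prime p -> (0 < d)%N ->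
  (exists n : nat, (p %| n ^ 2 + d)%N) ->
  exists a b c x y : int,
    [/\ 0 < a, a <= c, `|2 * b| <= a, a * c = d%:Z + b ^+ 2 &
        p%:Z = a * x ^+ 2 + 2 * b * x * y + c * y ^+ 2].
Proof.
move=> /prime_gt0 p_gt0 d_gt0 [n /dvdnP[m Em]].
(* As n^2 + d = m p, the form p x^2 + 2n x y + m y^2 has determinant d and value p at (1, 0). *)
have [||||a [b [c [x [y [? ? ? ? E]]]]]] := @reduce_form d p n m 1 0.
- by [].
- by case: m Em => // /eqP; rewrite mul0n addn_eq0 (gtn_eqF d_gt0) andbF.
- by [].
- by rewrite -PoszM mulnC -Em PoszD addrC.
by exists a, b, c, x, y; split=> //; rewrite -E; ring.
Qed.

(** * Primes of the form x^2 + 6 y^2 or x^2 + 22 y^2 *)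

Lemma prime_sqrD6 (p : nat) : prime p -> (p %% 24 \in [:: 1; 7])%N ->
  exists x y : int, p%:Z = x ^+ 2 + 6 * y ^+ 2.
Proof.
move=> p_prime p24.
have [//|a [b [c [x [y [a_gt0 le_ac ba disc E]]]]]] :=
  prime_reduced_form p 6 p_prime _ (dvdn_sqrD6 p p_prime p24).
(* a^2 <= a c = 6 + b^2 <= 6 + a^2 / 4. *)
have a3 : 3 * a ^+ 2 <= 4 * 6 by nia.
have a2 : a <= 2 by nia.
have [a1|a2'] : a = 1 \/ a = 2 by lia.
  subst a; have b0 : b = 0 by lia.
  subst b; have c6 : c = 6 by lia.
  by subst c; exists x, y; rewrite E; ring.
subst a; have [b1|b0] : b ^+ 2 = 1 \/ b = 0 by nia.
  lia.
subst b; have c3 : c = 3 by lia.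
subst c; rewrite !inE in p24.
(* Modulo 3, 2 x^2 + 3 y^2 is 0 or 2, whereas p is 1. *)
have [k [r [xkr r_ge0 r_lt3]]] : exists k r : int, [/\ x = 3 * k + r, 0 <= r & r < 3].
  by exists (x %/ 3)%Z, (x %% 3)%Z; split; lia.
have {}E : p%:Z = 3 * (6 * k ^+ 2 + 4 * k * r + y ^+ 2) + 2 * r ^+ 2.
  by rewrite E xkr; ring.
have [r0|[r1|r2]] : r = 0 \/ r = 1 \/ r = 2 by lia.
- by subst r; lia.
- by subst r; lia.
- by subst r; lia.
Qed.

Lemma prime_sqrD22 (p : nat) : prime p -> (p %% 8 \in [:: 1; 7])%N ->
  (p %% 11 \in [:: 1; 3; 4; 5; 9])%N ->
  exists x y : int, p%:Z = x ^+ 2 + 22 * y ^+ 2.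
Proof.
move=> p_prime p8 p11.
have [//|a [b [c [x [y [a_gt0 le_ac ba disc E]]]]]] :=
  prime_reduced_form p 22 p_prime _ (dvdn_sqrD22 p p_prime p8 p11).
have a3 : 3 * a ^+ 2 <= 4 * 22 by nia.
have a5 : a <= 5 by nia.
have b2 : b = 0 \/ b = 1 \/ b = -1 \/ b = 2 \/ b = -2 by lia.
have [[a1 [b0 c22]]|[a2 [b0 c11]]] : (a = 1 /\ b = 0 /\ c = 22) \/ (a = 2 /\ b = 0 /\ c = 11).
  have [|[|[|[|]]]] : a = 1 \/ a = 2 \/ a = 3 \/ a = 4 \/ a = 5 by lia.
  1-5: by move=> a_eq; subst a; case: b2 => [|[|[|[|]]]] b_eq; subst b; lia.
  by exists x, y; rewrite E a1 b0 c22; ring.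
(* 2 is not a square modulo 11, so 2 x^2 cannot be congruent to the nonzero square p. *)
have [k [r [xkr r_ge0 r_lt11]]] : exists k r : int, [/\ x = 11 * k + r, 0 <= r & r < 11].
  by exists (x %/ 11)%Z, (x %% 11)%Z; split; lia.
have {}E : p%:Z = 11 * (22 * k ^+ 2 + 4 * k * r + y ^+ 2) + 2 * r ^+ 2.
  by rewrite E xkr a2 b0 c11; ring.
rewrite !inE in p11.
case: r r_ge0 r_lt11 E {xkr} => // r _ r_lt11 E.
do 11?[case: r r_lt11 E => [|r] r_lt11 E; first lia].
lia.
Qed.

(** * Parity conditions and commuting quaternions *)

Lemma evenz_sqr (x : int) : evenz x -> exists k : int, x ^+ 2 = 4 * k.
Proof. by case/dvdzP=> k ->; exists (k ^+ 2); ring. Qed.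

Lemma oddz_sqr (x : int) : oddz x -> exists k : int, x ^+ 2 = 8 * k + 1.
Proof.
rewrite /oddz /evenz => x_odd.
have [k ->] : exists k : int, x = 2 * k + 1 by exists (x %/ 2)%Z; lia.
have [h hk] : exists h : int, k * (k + 1) = 2 * h.
  have [[h ->]|[h ->]] : (exists h : int, k = 2 * h) \/ (exists h : int, k = 2 * h + 1).
    by have [?|?] : (k %% 2)%Z = 0 \/ (k %% 2)%Z = 1; [lia|left|right]; exists (k %/ 2)%Z; lia.
    by exists (h * (2 * h + 1)); ring.
  by exists ((2 * h + 1) * (h + 1)); ring.
by exists h; transitivity (4 * (k * (k + 1)) + 1); [ring|rewrite hk; ring].
Qed.

(** Since p is odd, so is x, and p is 1 + 6 y^2 modulo 8; hence y is even if p is 1 modulo 8 and odd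
    if p is 7. *)
Lemma mem_X_of_form (p : nat) (m x y : int) :
  (p %% 8 \in [:: 1; 7])%N -> oddz m ->
  p%:Z = x ^+ 2 + (4 + 2 * m ^+ 2) * y ^+ 2 ->
  Quat x (2 * y) (m * y) (m * y) \in X p.
Proof.
rewrite !inE => p8 m_odd E; have [mm mmE] := oddz_sqr _ m_odd.
have x_odd : oddz x.
  apply/negP => /evenz_sqr[k xk].
  by move: E; rewrite xk mmE mulrDl; lia.
have [k xk] := oddz_sqr _ x_odd.
rewrite unfold_in /X /normsq /=.
apply/and3P; split.
- by rewrite E; apply/eqP; ring.
- apply/implyP => /eqP p4; have p1 : (p %% 8 = 1)%N by lia.
  have y_even : evenz y.
    apply: contraT => /oddz_sqr[h yh].
    by move: E; rewrite xk mmE yh; lia.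
  by rewrite x_odd /evenz dvdz_mulr // dvdz_mull.
apply/implyP => /eqP p4; have p1 : (p %% 8 = 7)%N by lia.
have y_odd : oddz y.
  apply/negP => /evenz_sqr[h yh].
  by move: E; rewrite xk mmE yh; lia.
rewrite x_odd /oddz /evenz dvdz_mulr //=.
by move: m_odd y_odd; rewrite /oddz /evenz !dvdzE !abszM !Euclid_dvdM // => /negPf-> /negPf->.
Qed.

Lemma quat_parallel_comm (R : comNzRingType) (a b c1 c2 c3 d e : R) :
  Quat a (c1 * b) (c2 * b) (c3 * b) * Quat d (c1 * e) (c2 * e) (c3 * e) =
  Quat d (c1 * e) (c2 * e) (c3 * e) * Quat a (c1 * b) (c2 * b) (c3 * b).
Proof. by congr Quat => /=; ring. Qed.

Lemma commuting_in_X6 (p l : nat) : prime p -> prime l ->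
  (p %% 24 \in [:: 1; 7])%N -> (l %% 24 \in [:: 1; 7])%N ->
  exists x y : quat int, [/\ x \in X p, y \in X l & x * y = y * x].
Proof.
move=> p_prime l_prime p24 l24.
have [a [b pE]] := prime_sqrD6 _ p_prime p24.
have [d [e lE]] := prime_sqrD6 _ l_prime l24.
(* Here m = 1, as 4 + 2 * 1^2 = 6; [1 * b] keeps the shape that both lemmas match. *)
exists (Quat a (2 * b) (1 * b) (1 * b)), (Quat d (2 * e) (1 * e) (1 * e)).
split; last exact: quat_parallel_comm.
  by apply: mem_X_of_form => //; rewrite !inE in p24 *; lia.
by apply: mem_X_of_form => //; rewrite !inE in l24 *; lia.
Qed.

Lemma commuting_in_X22 (p l : nat) : prime p -> prime l ->
  (p %% 8 \in [:: 1; 7])%N -> (p %% 11 \in [:: 1; 3; 4; 5; 9])%N ->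
  (l %% 8 \in [:: 1; 7])%N -> (l %% 11 \in [:: 1; 3; 4; 5; 9])%N ->
  exists x y : quat int, [/\ x \in X p, y \in X l & x * y = y * x].
Proof.
move=> p_prime l_prime p8 p11 l8 l11.
have [a [b pE]] := prime_sqrD22 _ p_prime p8 p11.
have [d [e lE]] := prime_sqrD22 _ l_prime l8 l11.
(* Here m = 3, as 4 + 2 * 3^2 = 22. *)
exists (Quat a (2 * b) (3 * b) (3 * b)), (Quat d (2 * e) (3 * e) (3 * e)).
split; last exact: quat_parallel_comm.
  exact: mem_X_of_form.
exact: mem_X_of_form.
Qed.

Local Close Scope ring_scope.

Theorem proposition25 (p l : nat) (p_prime : prime p) (l_prime : prime l)
    (p_odd : odd p) (l_odd : odd l) (p_neq_l : p <> l) :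
  ((p = 7 %[mod 24] /\ l = 7 %[mod 24]) \/
   (p %% 88 \in [:: 15; 23; 31; 47; 71] /\
    l %% 88 \in [:: 15; 23; 31; 47; 71]) ->
   exists x y : quat int, [/\ x \in X p, y \in X l & (x * y = y * x)%R])
  /\
  ((p = 1 %[mod 24] /\ l = 7 %[mod 24]) \/
   (p %% 88 \in [:: 1; 9; 25; 49; 81] /\
    l %% 88 \in [:: 15; 23; 31; 47; 71]) ->
   exists x y : quat int, [/\ x \in X p, y \in X l & (x * y = y * x)%R]).
Proof.
split=> -[[p24 l24]|[p88 l88]].
- by apply: commuting_in_X6; rewrite ?p24 ?l24.
(* These residues modulo 88 are exactly those that are 7 modulo 8 and nonzero squares modulo 11. *)
- by apply: commuting_in_X22 => //; rewrite !inE in p88 l88 *; lia.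
- by apply: commuting_in_X6; rewrite ?p24 ?l24.
- by apply: commuting_in_X22 => //; rewrite !inE in p88 l88 *; lia.
Qed.
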